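(* Let $\dim V=2n\ge 4$ and fix $J\in\mathcal{T}(V,g)$. Let $QS\in\Gamma(\mathfrak{gl}(\mathbb{V}))$ be such that $Q=a_{k}\{J,\phi\}^{k}+\dots+a_{1}\{J,\phi\}+a_{0}\mathbb{1}$ with $a_{i}\in C^{\infty}(\mathcal{T})$, and $S\in\{\mathbb{1},\,J+\phi,\,J-\phi,\,[J,\phi]\}$. Moreover, suppose $a_{i}\in\mathbb{R}[f_{1},\dots,f_{2n}]$ for every $i$, where the $f_{j}\in C^{\infty}(\mathcal{T})$ are defined via $$\det(\lambda\mathbb{1}-\{J,\phi\})=\lambda^{2n}-f_{1}\lambda^{2n-1}+\dots-f_{2n-1}\lambda+f_{2n}.$$ Then $$\mathcal{D}^{QS}_{\mathfrak{u}(J)}=\{[B,\phi]\in\mathfrak{o}_{\{\phi\}} \ |\ B\in\mathfrak{u}(V,J),\ B:\mathrm{Ker}QS\to 0,\ \mathrm{Im}QS\to\mathrm{Im}QS\}$$ (defined pointwise on $\mathcal{T}$) is an integrable distribution on $\mathcal{T}(V,g)$.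
   Context: $(V,g)$ is a $2n$-dimensional real vector space with a positive definite metric. $\mathcal{T}=\mathcal{T}(V,g)=\{K\in \mathrm{End}V : K^{2}=-1,\ g(K\cdot,K\cdot)=g(\cdot,\cdot)\}$, a submanifold of $\mathrm{End}V$. $\mathbb{V}=V\times\mathcal{T}$, $\mathfrak{gl}(\mathbb{V})=\mathrm{End}V\times\mathcal{T}$. $\phi$ is the section with $\phi|_K=K$; $J$ and $\mathbb{1}$ are regarded as constant sections. $[A,B]=AB-BA$, $\{A,B\}=AB+BA$. $\mathfrak{o}_{\{\phi\}}$ is the bundle over $\mathcal{T}$ with fiber $\{A\in\mathfrak{o}(V,g):AK+KA=0\}$ at $K$; it is identified with $T\mathcal{T}$. $\mathfrak{u}(V,J)=\{A\in\mathfrak{o}(V,g):[A,J]=0\}$. Integrability is in the generalized sense (rank may vary): through each point of $\mathcal{T}$ passes an integral submanifold, i.e. one whose tangent space at each of its points equals the distribution there. *)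

(* Defs.v *)
From HB Require Import structures.
From mathcomp Require Import all_boot all_order all_algebra.
From mathcomp Require Import sesquilinear.
From mathcomp Require Import all_classical all_reals all_analysis.

Set Implicit Arguments.
Unset Strict Implicit.
Unset Printing Implicit Defensive.

Import Order.TTheory GRing.Theory Num.Theory.
Import numFieldNormedType.Exports.

Local Open Scope classical_set_scope.
Local Open Scope ring_scope.

Section Submanifolds.
Context {R : realType}.

Definition iter_derive {E F : normedModType R} (s : seq E) (f : E -> F) :
    E -> F :=
  foldr (fun v h => 'D_v h) f s.

(* C^oo on an open subset U of a finite-dimensional E: all iterated directional
   derivatives exist and are continuous on U.  As U is open, the derivatives at
   its points do not depend on the values of f outside U. *)
Definition smooth_on {E F : normedModType R} (U : set E) (f : E -> F) : Prop :=
  forall (s : seq E) (x : E), U x ->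
    {for x, continuous (iter_derive s f)} /\
    forall v : E, derivable (iter_derive s f) x v.

(* h is a smooth immersion of the open set O of R^d which is a homeomorphism
   onto the relatively open subset N `&` U of N. *)
Definition local_parametrization {E : normedModType R} (N : set E) (d : nat)
    (O : set 'rV[R]_d) (U : set E) (h : 'rV[R]_d -> E) : Prop :=
  [/\ open O /\ open U,
      smooth_on O h,
      forall x v : 'rV[R]_d, O x -> 'D_v h x = 0 -> v = 0,
      h @` O = N `&` U
    & exists2 k : E -> 'rV[R]_d,
        forall x, O x -> k (h x) = x & {within N `&` U, continuous k}].

Definition submanifold {E : normedModType R} (N : set E) : Prop :=
  exists d : nat, forall p, N p ->
    exists (O : set 'rV[R]_d) (U : set E) (h : 'rV[R]_d -> E),
      U p /\ local_parametrization N O U h.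

(* Velocities at p of the smooth curves lying in N. *)
Definition tangent_space {E : normedModType R} (N : set E) (p : E) : set E :=
  [set w | exists (I : set R^o) (c : R^o -> E),
     [/\ open I /\ I 0, smooth_on I c, forall t, I t -> N (c t),
         c 0 = p & 'D_1 c 0 = w]].

Definition smooth_function {E : normedModType R} (N : set E) (f : E -> R) :
    Prop :=
  forall p, N p -> exists (U : set E) (F : E -> R^o),
    [/\ open U, U p, smooth_on U F & forall q, N q -> U q -> f q = F q].

Definition linear_subspace {E : normedModType R} (W : set E) : Prop :=
  W 0 /\ forall (a : R) (x y : E), W x -> W y -> W (a *: x + y).

(* No constancy of the rank is required. *)
Definition tangent_distribution {E : normedModType R} (T : set E)
    (D : E -> set E) : Prop :=
  forall p, T p -> linear_subspace (D p) /\ D p `<=` tangent_space T p.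

Definition integral_submanifold {E : normedModType R} (T : set E)
    (D : E -> set E) (N : set E) : Prop :=
  [/\ N `<=` T, submanifold N & forall q, N q -> tangent_space N q = D q].

Definition integrable_distribution {E : normedModType R} (T : set E)
    (D : E -> set E) : Prop :=
  tangent_distribution T D /\
  forall p, T p -> exists2 N : set E, N p & integral_submanifold T D N.

End Submanifolds.

Section Endomorphisms.
Context {R : realType} {V : vectType R}.
Implicit Types A B J K : 'End(V).

Definition commutator A B : 'End(V) := ((A \o B) - (B \o A))%VF.
Definition anticommutator A B : 'End(V) := ((A \o B) + (B \o A))%VF.
Definition endo_exp A (i : nat) : 'End(V) := iter i (comp_lfun A) \1%VF.

(* The linear isomorphism between End V and square matrices given by a basis of
   V.  It carries the topology and smooth structure of the matrix space to End V,
   and these do not depend on the basis.  Matrices act on row vectors, so that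
   composition is reversed, which is irrelevant here. *)
Definition endo_mx A : 'M[R]_(\dim {:V}) :=
  passmx.mxof (vbasis {:V}) (vbasis {:V}) A.
Definition mx_endo (M : 'M[R]_(\dim {:V})) : 'End(V) :=
  passmx.hommx (vbasis {:V}) (vbasis {:V}) M.

Definition endo_char_poly A : {poly R} := char_poly (endo_mx A).

Variable g : {dot V for idfun}.

Definition twistor : set 'End(V) :=
  [set K | (K \o K)%VF = (- \1)%VF /\ forall u v, g (K u) (K v) = g u v].

Definition skew_endo : set 'End(V) :=
  [set A | forall u v, g (A u) v = - g u (A v)].

Definition unitary_alg J : set 'End(V) :=
  [set A | skew_endo A /\ commutator A J = 0].

(* The fibre at K of o_{phi}, i.e. the tangent space of the twistor space. *)
Definition skew_acomm K : set 'End(V) :=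
  [set A | skew_endo A /\ anticommutator A K = 0].

Definition smooth_on_twistor (a : 'End(V) -> R) : Prop :=
  smooth_function (endo_mx @` twistor) (a \o mx_endo).

Definition integrable_on_twistor (D : 'End(V) -> set 'End(V)) : Prop :=
  integrable_distribution (endo_mx @` twistor)
    (fun M => endo_mx @` D (mx_endo M)).

(* P is the section QS. *)
Definition twistor_dist J (P : 'End(V) -> 'End(V)) K : set 'End(V) :=
  [set A | skew_acomm K A /\ exists B,
     [/\ unitary_alg J B,
         forall v, v \in lker (P K) -> B v = 0,
         forall v, v \in limg (P K) -> B v \in limg (P K)
       & A = commutator B K]].

End Endomorphisms.

(* Main.v *)
Require Import Defs.
From HB Require Import structures.
From mathcomp Require Import all_boot all_order all_algebra.
From mathcomp Require Import sesquilinear.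
From mathcomp Require Import all_classical all_reals all_analysis.
From mathcomp Require mpoly.
From mathcomp Require Import lra.

Set Implicit Arguments.
Unset Strict Implicit.
Unset Printing Implicit Defensive.

Import Order.TTheory GRing.Theory Num.Theory.
Import numFieldNormedType.Exports.

Local Open Scope classical_set_scope.
Local Open Scope ring_scope.

(** A unitary [b] commutes with [J], so it carries [{J, K}] to [{J, bKb^-1}] by
conjugation; the characteristic polynomial, hence each [f j], hence each
coefficient [a i], takes the same value at [K] and at [bKb^-1], and therefore
the section [P = QS] satisfies [P (bKb^-1) = b (P K) b^-1]
([twistor_dist_integrable] uses only this equivariance).  Fix [K] and let [gg]
be the Lie algebra of the [B] in [u(V, J)] that kill [Ker (P K)] and preserve
[Im (P K)].  When [b] is the Cayley transform of an element of [gg], it is the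
identity on [Ker (P K)] and preserves [Im (P K)], so that [P (bKb^-1)] has the
same kernel and the same image as [P K] ([lker_conj], [limg_conj]): the algebra
[gg] is also the one attached to [bKb^-1], and the distribution at [bKb^-1] is
[{[B, bKb^-1] | B in gg}].  The integral submanifold through [K] is thus a piece
of the orbit of [K] under the group of [gg].

That a small piece of such an orbit is a submanifold with the expected tangent
spaces is [orbit_germ].  The Cayley transform [c(X) = (1 + X) / (1 - X)] replaces
the exponential: it is rational, and defined on all of [gg], because a skew
endomorphism has no nonzero real eigenvalue.  Let [x |-> X(x)] be a linear
parametrization of a complement in [gg] of the stabilizer of [p]; the chart is
[x |-> c(X(x)) p c(X(x))^-1] on a small ball.

The resolvent identity gives an exact difference formula
[chart x - chart y = chart_slope x y (x - y)], where [chart_slope x y] is a linear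
map depending jointly continuously on [x] and [y].  At [(0, 0)] this map has a
linear left inverse, so near [(0, 0)] it is bounded below by a definite factor
([coslice_expanding]).  Hence the chart is injective with Lipschitz
inverse, it is an immersion, and any smooth curve in its image has the form
[chart (y t)], where the quotients [(y t - y 0) / t] converge.  The tangent space
at [chart x] is then the range of [chart_slope x x], which lies in [[gg, chart x]]
and equals it because the two dimensions agree ([dim_ad_orbit]). *)

(** * Convergence of matrices *)

Section MatrixTopology.
Context {R : realType}.

Lemma cvg_mxE {T : Type} {F : set_system T} {FF : Filter F} m n
    (f : T -> 'M[R]_(m, n)) (A : 'M[R]_(m, n)) :
  (forall i j, f x i j @[x --> F] --> A i j) -> f @ F --> A.
Proof.
move=> fA; apply/cvg_ballP => e e0; near=> x; split=> //; near: x.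
apply: filter_forall => i; apply: filter_forall => j.
by move/cvg_ballP : (fA i j); exact.
Unshelve. all: by end_near. Qed.

Lemma cvg_mx_coord {T : Type} {F : set_system T} {FF : Filter F} m n
    (f : T -> 'M[R]_(m, n)) (A : 'M[R]_(m, n)) i j :
  f @ F --> A -> f x i j @[x --> F] --> A i j.
Proof.
move=> fA; apply: (continuous_cvg _ (@coord_continuous _ _ _ i j A)).
exact: fA.
Qed.

Lemma cvg_bigsum {T : Type} {F : set_system T} {FF : Filter F} {W : normedModType R}
    (I : Type) (r : seq I) (P : pred I) (f : I -> T -> W) (l : I -> W) :
  (forall i, P i -> f i x @[x --> F] --> l i) ->
  \sum_(i <- r | P i) f i x @[x --> F] --> \sum_(i <- r | P i) l i.
Proof.
move=> fl; elim: r => [|i r ih].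
  by rewrite big_nil; under eq_fun do rewrite big_nil; exact: cvg_cst.
rewrite big_cons; under eq_fun do rewrite big_cons.
by case: ifP => // Pi; apply: cvgD => //; exact: fl.
Qed.

Lemma cvg_bigprod {T : Type} {F : set_system T} {FF : Filter F}
    (I : Type) (r : seq I) (P : pred I) (f : I -> T -> R) (l : I -> R) :
  (forall i, P i -> f i x @[x --> F] --> l i) ->
  \prod_(i <- r | P i) f i x @[x --> F] --> \prod_(i <- r | P i) l i.
Proof.
move=> fl; elim: r => [|i r ih].
  by rewrite big_nil; under eq_fun do rewrite big_nil; exact: cvg_cst.
rewrite big_cons; under eq_fun do rewrite big_cons.
by case: ifP => // Pi; apply: cvgM => //; exact: fl.
Qed.

Lemma cvg_mulmx {T : Type} {F : set_system T} {FF : Filter F} m n p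
    (f : T -> 'M[R]_(m, n)) (g : T -> 'M[R]_(n, p))
    (A : 'M[R]_(m, n)) (B : 'M[R]_(n, p)) :
  f @ F --> A -> g @ F --> B -> f x *m g x @[x --> F] --> A *m B.
Proof.
move=> fA gB; apply: cvg_mxE => i j; rewrite mxE.
under eq_fun do rewrite mxE.
by apply: cvg_bigsum => k _; apply: cvgM; apply: cvg_mx_coord.
Qed.

Lemma cvg_det {T : Type} {F : set_system T} {FF : Filter F} m
    (f : T -> 'M[R]_m) (A : 'M[R]_m) :
  f @ F --> A -> \det (f x) @[x --> F] --> \det A.
Proof.
move=> fA; rewrite /determinant; apply: cvg_bigsum => s _.
apply: cvgM; first exact: cvg_cst.
by apply: cvg_bigprod => i _; apply: cvg_mx_coord.
Qed.

(** Cramer's formula expresses the inverse through determinants of minors, which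
are polynomials in the entries. *)
Lemma cvg_invmx {T : Type} {F : set_system T} {FF : Filter F} m
    (f : T -> 'M[R]_m) (A : 'M[R]_m) :
  (forall x, f x \in unitmx) -> A \in unitmx ->
  f @ F --> A -> invmx (f x) @[x --> F] --> invmx A.
Proof.
move=> fu Au fA; rewrite /invmx Au; under eq_fun do rewrite fu.
apply: cvgZ.
  apply: cvgV; last exact: cvg_det.
  by move: Au; rewrite unitmxE unitfE.
apply: cvg_mxE => i j; rewrite mxE; under eq_fun do rewrite mxE.
apply: cvgM; first exact: cvg_cst.
apply: cvg_det; apply: cvg_mxE => k l; rewrite !mxE.
by under eq_fun do rewrite !mxE; apply: cvg_mx_coord.
Qed.

Lemma linear_mx_continuous m n (W : normedModType R)
  (L : {linear 'M[R]_(m, n) -> W}) : continuous L.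
Proof.
pose G (B : 'M[R]_(m, n)) : W := \sum_i \sum_j B i j *: L (delta_mx i j).
have -> : (L : _ -> _) = G.
  apply/funext => B; rewrite [B in LHS]matrix_sum_delta linear_sum.
  apply: eq_bigr => i _.
  by rewrite linear_sum; apply: eq_bigr => j _; rewrite linearZ.
move=> A; rewrite /continuous_at /G.
apply: (@cvg_bigsum _ (nbhs A)) => i _; apply: (@cvg_bigsum _ (nbhs A)) => j _.
by apply: (@cvgZr_tmp _ _ _ (nbhs A)); exact: (@coord_continuous _ m n i j A).
Qed.

Lemma mx_norm_coord m n (A : 'M[R]_(m, n)) i j : `|A i j| <= `|A|.
Proof.
by rewrite [leRHS]/Num.Def.normr/= mx_normrE; exact: (le_bigmax _ _ (i, j)).
Qed.

(** The norm is the largest absolute value of an entry, whence the factor [m]. *)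
Lemma mx_norm_mulmx m n (v : 'rV[R]_m) (A : 'M[R]_(m, n)) :
  `|v *m A| <= m%:R * `|v| * `|A|.
Proof.
rewrite [leLHS]/Num.Def.normr/= mx_normrE; apply: bigmax_le.
  by apply: mulr_ge0 => //; apply: mulr_ge0.
move=> [i j] _ /=; rewrite mxE; apply: le_trans (ler_norm_sum _ _ _) _.
apply: (@le_trans _ _ (\sum_(k < m) `|v| * `|A|)).
  by apply: ler_sum => k _; rewrite normrM ler_pM// mx_norm_coord.
by rewrite sumr_const card_ord -mulrA mulr_natl.
Qed.

End MatrixTopology.

(** * The Cayley transform *)

(** Both definitions are locked because otherwise matching a product of
differences would unfold [cayley] to its defining difference. *)
HB.lock Definition resolvent (R : realType) (m : nat) (X : 'M[R]_m) : 'M[R]_m :=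
  invmx (1%:M - X).
(** This is [(1 + X) (1 - X)^-1], written so that its increments are twice those
of the resolvent. *)
HB.lock Definition cayley (R : realType) (m : nat) (X : 'M[R]_m) : 'M[R]_m :=
  2 *: resolvent X - 1%:M.

Section Cayley.
Context {R : realType} {m : nat}.
Implicit Types X Y : 'M[R]_m.

Lemma mulBmx_resolvent X : 1%:M - X \in unitmx ->
  (1%:M - X) *m resolvent X = 1%:M.
Proof. by rewrite resolvent.unlock; exact: mulmxV. Qed.

Lemma resolvent_mulBmx X : 1%:M - X \in unitmx ->
  resolvent X *m (1%:M - X) = 1%:M.
Proof. by rewrite resolvent.unlock; exact: mulVmx. Qed.

(** The resolvent identity: an exact formula for the increment, linear in
[X - Y].  It gives both the derivatives and the difference formula for orbits. *)
Lemma resolventB X Y : 1%:M - X \in unitmx -> 1%:M - Y \in unitmx ->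
  resolvent X - resolvent Y = resolvent X *m (X - Y) *m resolvent Y.
Proof.
move=> uX uY; have -> : X - Y = (1%:M - Y) - (1%:M - X).
  by rewrite opprB [RHS]addrC addrA subrK.
rewrite mulmxBr mulmxBl -mulmxA mulBmx_resolvent// mulmx1.
by rewrite resolvent_mulBmx// mul1mx.
Qed.

Lemma resolventDN X : 1%:M - X \in unitmx -> 1%:M + X \in unitmx ->
  resolvent X + resolvent (- X) = 2 *: (resolvent X *m resolvent (- X)).
Proof.
move=> uX uX'; have uN : 1%:M - (- X) \in unitmx by rewrite opprK.
have -> : resolvent X + resolvent (- X) =
   resolvent X *m ((1%:M - - X) + (1%:M - X)) *m resolvent (- X).
  rewrite mulmxDr mulmxDl -mulmxA mulBmx_resolvent// mulmx1.
  by rewrite resolvent_mulBmx// mul1mx.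
rewrite opprK addrACA subrr addr0 -mulr2n -scaler_nat -scalemxAr mulmx1.
by rewrite scalemxAl.
Qed.

Lemma cayley_mulN X : 1%:M - X \in unitmx -> 1%:M + X \in unitmx ->
  cayley X *m cayley (- X) = 1%:M.
Proof.
move=> uX uX'; rewrite cayley.unlock mulmxBl mul1mx mulmxBr mulmx1.
rewrite -scalemxAl -scalemxAr -resolventDN// scalerDr.
by rewrite [X in X - _]addrAC subrr add0r opprB addrC subrK.
Qed.

Lemma cayley0 : cayley (0 : 'M[R]_m) = 1%:M.
Proof.
by rewrite cayley.unlock resolvent.unlock subr0 invmx1 scaler_nat mulr2n addrK.
Qed.

Lemma cayleyB X Y : 1%:M - X \in unitmx -> 1%:M - Y \in unitmx ->
  cayley X - cayley Y = 2 *: (resolvent X *m (X - Y) *m resolvent Y).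
Proof.
by move=> uX uY; rewrite cayley.unlock opprB addrA subrK -scalerBr resolventB.
Qed.

Lemma resolventN_cayley X : 1%:M - X \in unitmx -> 1%:M + X \in unitmx ->
  resolvent (- X) *m cayley X = resolvent X.
Proof.
move=> uX uX'; rewrite cayley.unlock mulmxBr mulmx1 -scalemxAr.
have -> : 2 *: (resolvent (- X) *m resolvent X) = resolvent X + resolvent (- X).
  by rewrite -[X in _ *m resolvent X]opprK -resolventDN ?opprK// addrC.
by rewrite addrK.
Qed.

Lemma cayley_resolventN X : 1%:M - X \in unitmx -> 1%:M + X \in unitmx ->
  cayley X *m resolvent (- X) = resolvent X.
Proof.
move=> uX uX'; rewrite cayley.unlock mulmxBl mul1mx -scalemxAl -resolventDN//.
by rewrite addrK.
Qed.

End Cayley.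

(** * Smoothness of words in resolvents *)

Section Smoothness.
Context {R : realType} {E : normedModType R} {m : nat}.

Lemma is_derive_cvg {W : normedModType R} (f : E -> W) x v l :
  t^-1 *: (f (t *: v + x) - f x) @[t --> (0 : R)^'] --> l -> is_derive x v f l.
Proof.
by move=> fl; split; [exact: (cvgP _ fl) | exact: cvg_lim].
Qed.

Lemma is_derive_cvgE {W : normedModType R} (f : E -> W) x v l :
  is_derive x v f l -> t^-1 *: (f (t *: v + x) - f x) @[t --> (0 : R)^'] --> l.
Proof. by case=> fl <-. Qed.

Lemma cvg_line (x v : E) : (fun t : R => t *: v + x) @ (0 : R)^' --> x.
Proof.
rewrite -[X in _ --> X]add0r -[X in _ --> X + _](scale0r v).
apply: cvgD; last exact: cvg_cst.
by apply: cvgZr_tmp; exact: nbhs_dnbhs.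
Qed.

Variables (A B : E -> 'M[R]_m).

(** A class of functions, closed under directional derivatives, that contains the
conjugates [cayley (A x) *m p *m cayley (- A x)] when [A] is affine: the
derivative of a resolvent is again a product of resolvents and constants. *)
Inductive cayley_word : (E -> 'M[R]_m) -> Prop :=
| cw_cst M : cayley_word (fun=> M)
| cw_res (b : R) : cayley_word (fun x => resolvent (b *: A x))
| cw_add f g : cayley_word f -> cayley_word g -> cayley_word (fun x => f x + g x)
| cw_mul f g : cayley_word f -> cayley_word g -> cayley_word (fun x => f x *m g x).

(* [B] is the linear part of the affine map [A]. *)
Hypothesis A_affine : forall x v (t : R), A (t *: v + x) = t *: B v + A x.
Hypothesis A_cont : continuous A.
Hypothesis A_unit : forall (b : R) x, 1%:M - b *: A x \in unitmx.

Lemma cayley_word_continuous f : cayley_word f -> continuous f.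
Proof.
elim=> {f} [M|b|f g _ fc _ gc|f g _ fc _ gc] x.
- exact: cvg_cst.
- rewrite resolvent.unlock; apply: (@cvg_invmx _ _ (nbhs x)) => //.
  by apply: cvgB; [exact: cvg_cst | apply: cvgZl_tmp; exact: A_cont].
- by apply: cvgD; [exact: fc | exact: gc].
- by apply: (@cvg_mulmx _ _ (nbhs x)); [exact: fc | exact: gc].
Qed.

Lemma cayley_word_derive f : cayley_word f -> forall v,
  exists2 f', cayley_word f' & forall x, is_derive x v f (f' x).
Proof.
move=> + v; elim=> {f} [M|b|f g cf [f' cf' df] cg [g' cg' dg]
                           |f g cf [f' cf' df] cg [g' cg' dg]].
- by exists (fun=> 0); [exact: cw_cst | move=> x; exact: is_derive_cst].
- exists (fun x => resolvent (b *: A x) *m (b *: B v) *m resolvent (b *: A x)).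
    by apply: cw_mul; [apply: cw_mul|]; [exact: cw_res|exact: cw_cst|exact: cw_res].
  move=> x; apply: is_derive_cvg.
  have rc := @cayley_word_continuous _ (cw_res b).
  have : resolvent (b *: A (t *: v + x)) *m (b *: B v) *m resolvent (b *: A x)
      @[t --> (0:R)^'] -->
      resolvent (b *: A x) *m (b *: B v) *m resolvent (b *: A x).
    apply: cvg_mulmx; last exact: cvg_cst.
    apply: cvg_mulmx; last exact: cvg_cst.
    exact: (@cvg_comp _ _ _ _ _ _ _ _ (@cvg_line x v) (rc x)).
  apply: cvg_trans; apply: near_eq_cvg; near=> t.
  have t0 : t != 0 by near: t; exact: nbhs_dnbhs_neq.
  rewrite resolventB// -scalerBr A_affine addrK.
  by rewrite -!(scalemxAr, scalemxAl) !scalerA mulrCA mulVf ?mulr1.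
- exists (fun x => f' x + g' x); first exact: cw_add.
  by move=> x; apply: is_deriveD.
- exists (fun x => f' x *m g x + f x *m g' x).
    by apply: cw_add; apply: cw_mul.
  move=> x; apply: is_derive_cvg.
  have gc := @cayley_word_continuous _ cg.
  have : (t^-1 *: (f (t *: v + x) - f x)) *m g (t *: v + x) +
         f x *m (t^-1 *: (g (t *: v + x) - g x)) @[t --> (0:R)^'] -->
         f' x *m g x + f x *m g' x.
    apply: cvgD; apply: cvg_mulmx.
    + exact: (is_derive_cvgE (df x)).
    + exact: (@cvg_comp _ _ _ _ _ _ _ _ (@cvg_line x v) (gc x)).
    + exact: cvg_cst.
    + exact: (is_derive_cvgE (dg x)).
  apply: cvg_trans; apply: near_eq_cvg; near=> t.
  (* the mixed terms [f x *m g (t *: v + x)] cancel *)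
  rewrite -scalemxAl -scalemxAr -scalerDr mulmxBl mulmxBr.
  by rewrite addrA subrK.
Unshelve. all: by end_near. Qed.

(** Iterated derivatives stay in the class, whose members are continuous; they
are globally defined, so the set [U] is arbitrary. *)
Lemma cayley_word_smooth U f : cayley_word f -> smooth_on U f.
Proof.
move=> cf; suff H s : cayley_word (iter_derive s f).
  move=> s x _; split; first exact: cayley_word_continuous.
  by move=> v; have [f' _ /(_ x) []] := cayley_word_derive (H s) v.
elim: s => [//|v s ih] /=; have [f' cf' df] := cayley_word_derive ih v.
rewrite (_ : (fun x => _) = f')//.
by apply/funext => x; have [] := df x.
Qed.

Lemma cayley_conj_word p :
  cayley_word (fun x => cayley (A x) *m p *m cayley (- A x)).
Proof.
have wcay b : cayley_word (fun x => 2%:M *m resolvent (b *: A x) + (- 1%:M)).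
  by apply: cw_add; [apply: cw_mul; [exact: cw_cst|exact: cw_res]|exact: cw_cst].
have := cw_mul (cw_mul (wcay 1) (cw_cst p)) (wcay (-1)).
congr cayley_word; apply/funext => x.
by rewrite cayley.unlock !mul_scalar_mx scale1r scaleN1r.
Qed.

End Smoothness.

(** * Conjugation orbits under Cayley transforms *)

Section Orbit.
Context {R : realType} {m : nat}.
Variables (gg : {vspace 'M[R]_m}) (p : 'M[R]_m).
Implicit Types X Y Z : 'M[R]_m.

(** The infinitesimal action of matrices on [q] by conjugation.  The argument [q]
comes first because the distribution is the image of a fixed space under [ad q]. *)
Definition ad (q : 'M[R]_m) : 'End('M[R]_m) :=
  (linfun (mulmxr q) - linfun (mulmx q))%R.

Lemma adE q X : ad q X = X *m q - q *m X.
Proof. by rewrite /ad add_lfunE opp_lfunE !lfunE. Qed.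

Definition cayley_orbit X := cayley X *m p *m cayley (- X).

(** The slope of [cayley_orbit] between [Y] and [X], in the direction [Z]; on the
diagonal it is the derivative. *)
Definition orbit_slope X Y Z :=
  2 *: (resolvent X *m Z *m resolvent Y *m p *m cayley (- X)) -
  2 *: (cayley Y *m p *m resolvent (- X) *m Z *m resolvent (- Y)).

Lemma orbit_slope_is_linear X Y : linear (orbit_slope X Y).
Proof.
move=> a Z Z'; rewrite /orbit_slope; move: (cayley (- X)) (cayley Y) => cX cY.
rewrite !(mulmxDl, mulmxDr) -!(scalemxAl,scalemxAr) -!scalerBr.
by rewrite scalerA [a * 2]mulrC -scalerA -scalerDr opprD addrACA scalerBr.
Qed.
HB.instance Definition _ X Y :=
  GRing.isSemilinear.Build R 'M[R]_m 'M[R]_m _ (orbit_slope X Y)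
    (GRing.semilinear_linear (orbit_slope_is_linear X Y)).

Hypothesis gg_unit : forall X, X \in gg -> 1%:M - X \in unitmx.
Hypothesis gg_resolvent : forall X Y, X \in gg -> Y \in gg ->
  resolvent X *m Y *m resolvent (- X) \in gg.
Hypothesis gg_cayley : forall X Y, X \in gg -> Y \in gg ->
  cayley X *m Y *m cayley (- X) \in gg.

Let gg_unitN X : X \in gg -> 1%:M + X \in unitmx.
Proof. by move=> gX; rewrite -[X]opprK gg_unit// memvN. Qed.

Lemma cayley_orbitB X Y : X \in gg -> Y \in gg ->
  cayley_orbit X - cayley_orbit Y = orbit_slope X Y (X - Y).
Proof.
move=> gX gY; rewrite /cayley_orbit /orbit_slope.
have -> : cayley X *m p *m cayley (- X) - cayley Y *m p *m cayley (- Y) =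
  (cayley X - cayley Y) *m p *m cayley (- X) +
  cayley Y *m p *m (cayley (- X) - cayley (- Y)).
  by rewrite !mulmxBl mulmxBr addrA subrK.
rewrite !cayleyB ?gg_unit ?memvN//.
rewrite -opprD; move: (X - Y) => D.
by rewrite mulmxN mulNmx scalerN mulmxN -!(scalemxAl,scalemxAr) !mulmxA.
Qed.

Lemma orbit_slope0 Z : orbit_slope 0 0 Z = 2 *: ad p Z.
Proof.
rewrite /orbit_slope adE oppr0 cayley0 resolvent.unlock subr0 invmx1 !mul1mx !mulmx1.
by rewrite scalerBr.
Qed.

(** With [q = c(X) p c(X)^-1] and [c'] the derivative of the Cayley transform at
[X] in the direction [Z], the derivative of the orbit map is the bracket of
[c' c(X)^-1 = 2 (1 - X)^-1 Z (1 + X)^-1] with [q]. *)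
Lemma orbit_slope_diag X Z : X \in gg ->
  orbit_slope X X Z = ad (cayley_orbit X) (2 *: (resolvent X *m Z *m resolvent (- X))).
Proof.
move=> gX; rewrite adE /orbit_slope /cayley_orbit -!scalemxAl -!scalemxAr.
congr (_ *: _ - _ *: _).
  rewrite !mulmxA -[_ *m resolvent (- X) *m cayley X]mulmxA.
  by rewrite resolventN_cayley ?gg_unit ?gg_unitN.
rewrite !mulmxA -[_ *m cayley (- X) *m resolvent X]mulmxA.
have := @cayley_resolventN _ _ (- X); rewrite opprK => ->//.
  exact: gg_unitN.
exact: gg_unit.
Qed.

Lemma cvg_orbit_slope {T : Type} {F : set_system T} {FF : Filter F}
    (X Y Z : T -> 'M[R]_m) (X0 Y0 Z0 : 'M[R]_m) :
  (forall t, X t \in gg) -> (forall t, Y t \in gg) -> X0 \in gg -> Y0 \in gg ->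
  X @ F --> X0 -> Y @ F --> Y0 -> Z @ F --> Z0 ->
  orbit_slope (X t) (Y t) (Z t) @[t --> F] --> orbit_slope X0 Y0 Z0.
Proof.
move=> gX gY gX0 gY0 cX cY cZ.
have cr (W : T -> 'M[R]_m) (W0 : 'M[R]_m) : (forall t, W t \in gg) ->
  W0 \in gg -> W @ F --> W0 -> resolvent (W t) @[t --> F] --> resolvent W0.
  move=> gW gW0 cW; rewrite resolvent.unlock;
    apply: cvg_invmx; [by move=> t; exact: gg_unit|exact: gg_unit|].
  by apply: cvgB => //; exact: cvg_cst.
have cc (W : T -> 'M[R]_m) (W0 : 'M[R]_m) : (forall t, W t \in gg) ->
  W0 \in gg -> W @ F --> W0 -> cayley (W t) @[t --> F] --> cayley W0.
  move=> gW gW0 cW; rewrite cayley.unlock; apply: cvgB; last exact: cvg_cst.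
  by apply: cvgZl_tmp; exact: cr.
have gXN t : - X t \in gg by rewrite memvN.
have gYN t : - Y t \in gg by rewrite memvN.
have gX0N : - X0 \in gg by rewrite memvN.
have gY0N : - Y0 \in gg by rewrite memvN.
have cXN : - X t @[t --> F] --> - X0 by apply: cvgN.
have cYN : - Y t @[t --> F] --> - Y0 by apply: cvgN.
apply: cvgB; apply: cvgZl_tmp.
  apply: cvg_mulmx; last exact: cc.
  apply: cvg_mulmx; last exact: cvg_cst.
  apply: cvg_mulmx; last exact: cr.
  by apply: cvg_mulmx => //; exact: cr.
apply: cvg_mulmx; last exact: cr.
apply: cvg_mulmx => //.
apply: cvg_mulmx; last exact: cr.
by apply: cvg_mulmx; [exact: cc|exact: cvg_cst].
Qed.

Lemma dim_limg_le (U : {vspace 'M[R]_m}) (f : 'End('M[R]_m)) :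
  (\dim (f @: U) <= \dim U)%N.
Proof. by rewrite -(limg_ker_dim f U) leq_addl. Qed.

(** Conjugation by [c(X)] maps [gg] to itself and [p] to [cayley_orbit X], so it
intertwines the two images. *)
Lemma dim_ad_orbit X : X \in gg ->
  (\dim (ad (cayley_orbit X) @: gg) <= \dim (ad p @: gg))%N.
Proof.
move=> gX.
pose cj : 'End('M[R]_m) := linfun (mulmx (cayley X) \o mulmxr (cayley (- X))).
apply: leq_trans (dim_limg_le (ad p @: gg) cj); apply: dimvS.
apply/subvP => _ /memv_imgP[Y gY ->].
have NX : - X \in gg by rewrite memvN.
have -> : ad (cayley_orbit X) Y = cj (ad p (cayley (- X) *m Y *m cayley X)).
  have cK := cayley_mulN (gg_unit gX) (gg_unitN gX).
  have cK' : cayley (- X) *m cayley X = 1%:M.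
    by have := cayley_mulN (gg_unit NX) (gg_unitN NX); rewrite opprK.
  rewrite [LHS]adE /cj lfunE /= adE mulmxBl mulmxBr /cayley_orbit !mulmxA cK mul1mx.
  by rewrite -[_ *m cayley X *m cayley (- X)]mulmxA cK mulmx1.
apply: memv_img; apply: memv_img.
by have := gg_cayley NX gY; rewrite opprK.
Qed.

End Orbit.

(** * The orbit germ as an integral submanifold *)

Section Germ.
Context {R : realType} {m : nat}.
Variables (gg : {vspace 'M[R]_m}) (p : 'M[R]_m).
Implicit Types X Y Z : 'M[R]_m.

Hypothesis gg_unit : forall X, X \in gg -> 1%:M - X \in unitmx.
Hypothesis gg_resolvent : forall X Y, X \in gg -> Y \in gg ->
  resolvent X *m Y *m resolvent (- X) \in gg.
Hypothesis gg_cayley : forall X Y, X \in gg -> Y \in gg ->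
  cayley X *m Y *m cayley (- X) \in gg.

(* The kernel of [ad p] in [gg] is the stabilizer of [p]. *)
Let compl : {vspace 'M[R]_m} := (gg :\: lker (ad p))%VS.
Let d := \dim compl.
Let b : d.-tuple 'M[R]_m := vbasis compl.

Definition slice (x : 'rV[R]_d) : 'M[R]_m := \sum_i x 0 i *: b`_i.

Lemma slice_is_linear : linear slice.
Proof.
move=> a x y; rewrite /slice linear_sum -big_split /=; apply: eq_bigr => i _.
by rewrite !mxE scalerDl scalerA.
Qed.
HB.instance Definition _ := GRing.isSemilinear.Build R 'rV[R]_d 'M[R]_m _ slice
    (GRing.semilinear_linear slice_is_linear).

Lemma slice_in x : slice x \in gg.
Proof.
apply: memv_suml => i _; apply: memvZ.
have /subvP := diffvSl gg (lker (ad p)); apply.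
by apply: vbasis_mem; rewrite mem_nth// size_tuple.
Qed.
Hint Resolve slice_in : core.

Lemma slice_continuous : continuous slice.
Proof. exact: (@linear_mx_continuous _ _ _ _ (slice : {linear _ -> _})). Qed.

Let fb : d.-tuple 'M[R]_m := map_tuple (ad p) b.

(** A linear left inverse, up to the factor 2 of [orbit_slope0], of the
infinitesimal action on the slice. *)
Definition coslice (Z : 'M[R]_m) : 'rV[R]_d := \row_i coord fb i (2^-1 *: Z).

Lemma coslice_is_linear : linear coslice.
Proof.
move=> a X Y; apply/rowP => i; rewrite !mxE scalerDr !linearD /= !linearZ /=.
by rewrite mulrCA.
Qed.
HB.instance Definition _ := GRing.isSemilinear.Build R 'M[R]_m 'rV[R]_d _ coslice
    (GRing.semilinear_linear coslice_is_linear).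

Lemma coslice_continuous : continuous coslice.
Proof. exact: (@linear_mx_continuous _ _ _ _ (coslice : {linear _ -> _})). Qed.

Lemma coslice_adK v : coslice (2 *: ad p (slice v)) = v.
Proof.
have bfb : basis_of (ad p @: compl) fb.
  by apply: limg_basis_of; [exact: capv_diff|exact: vbasisP].
apply/rowP => i; rewrite mxE scalerA mulVf// scale1r.
have -> : ad p (slice v) = \sum_(j < d) v 0 j *: fb`_j.
  rewrite linear_sum; apply: eq_bigr => j _.
  by rewrite linearZ /= (nth_map 0) ?size_tuple.
exact: (coord_sum_free _ _ (basis_free bfb)).
Qed.

Let chart x := cayley_orbit p (slice x).
Let chart_slope x y v := orbit_slope p (slice x) (slice y) (slice v).

Lemma chartB x y : chart x - chart y = chart_slope x y (x - y).
Proof.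
rewrite /chart (cayley_orbitB _ gg_unit)// /chart_slope.
by rewrite [slice (_ - _)]linearB.
Qed.

(** The slope read in the coordinates [coslice]: a square matrix, equal to the
identity at the origin. *)
Definition slope_mx x y : 'M[R]_d :=
  lin1_mx (coslice \o (orbit_slope p (slice x) (slice y) \o slice)).

Lemma slope_mxE x y v : v *m slope_mx x y = coslice (chart_slope x y v).
Proof. by rewrite mul_rV_lin1. Qed.

Lemma cvg_chart_slope {T : Type} {F : set_system T} {FF : Filter F}
    (x y z : T -> 'rV[R]_d) (x0 y0 z0 : 'rV[R]_d) :
  x @ F --> x0 -> y @ F --> y0 -> z @ F --> z0 ->
  chart_slope (x t) (y t) (z t) @[t --> F] --> chart_slope x0 y0 z0.
Proof.
move=> cx cy cz; apply: (cvg_orbit_slope gg_unit) => //.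
- exact: (@cvg_comp _ _ _ _ _ _ _ _ cx (@slice_continuous x0)).
- exact: (@cvg_comp _ _ _ _ _ _ _ _ cy (@slice_continuous y0)).
- exact: (@cvg_comp _ _ _ _ _ _ _ _ cz (@slice_continuous z0)).
Qed.

Lemma cvg_slope_mx {T : Type} {F : set_system T} {FF : Filter F}
    (x y : T -> 'rV[R]_d) (x0 y0 : 'rV[R]_d) :
  x @ F --> x0 -> y @ F --> y0 -> slope_mx (x t) (y t) @[t --> F] --> slope_mx x0 y0.
Proof.
move=> cx cy; apply: cvg_mxE => i j; rewrite mxE; under eq_fun do rewrite mxE.
apply: (@cvg_mx_coord _ _ _ _ _ _
  (fun t => coslice (chart_slope (x t) (y t) (delta_mx 0 i)))).
have ce : (delta_mx 0 i : 'rV[R]_d) @[_ --> F] --> (delta_mx 0 i : 'rV[R]_d).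
  exact: cvg_cst.
have cd : chart_slope (x t) (y t) (delta_mx 0 i) @[t --> F] -->
          chart_slope x0 y0 (delta_mx 0 i).
  exact: cvg_chart_slope.
exact: (@cvg_comp _ _ _ _ _ _ _ _ cd (@coslice_continuous _)).
Qed.

Lemma slope_mx0 : slope_mx 0 0 = 1%:M.
Proof.
apply/row_matrixP => i; rewrite !rowE slope_mxE mulmx1 /chart_slope.
rewrite !linear0 orbit_slope0.
exact: coslice_adK.
Qed.

(** [slope_mx x y] is close to the identity for small [x] and [y].  This single
estimate, uniform in both points, yields the injectivity of the chart, its
immersivity and the Lipschitz bound on its inverse. *)
Lemma coslice_expanding : exists2 e : R, 0 < e &
  forall x y, `|x| < e -> `|y| < e ->
  forall v, `|v| <= 2 * `|coslice (chart_slope x y v)|.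
Proof.
have : slope_mx z.1 z.2 @[z --> ((0, 0) : 'rV[R]_d * 'rV[R]_d)] --> slope_mx 0 0.
  apply: cvg_slope_mx; [exact: cvg_fst|exact: cvg_snd].
(* [v *m M] has norm at most [d] times the norms of [v] and [M], so this tolerance
   keeps the perturbation of [v] below half of its norm; [d] may be 0 *)
rewrite slope_mx0 => /cvgrPdist_le /(_ (2 * d.+1%:R)^-1).
rewrite invr_gt0 mulr_gt0// => /(_ isT) /nbhs_ballP[e /= e0 He].
exists e => // x y xe ye v.
have /He /= : ball ((0, 0) : 'rV[R]_d * 'rV[R]_d) e (x, y).
  by split; rewrite -ball_normE /ball_/= sub0r normrN.
move=> sl; rewrite -slope_mxE.
have -> : v *m slope_mx x y = v - v *m (1%:M - slope_mx x y).
  by rewrite mulmxBr mulmx1 opprB addrCA subrr addr0.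
have H : `|v *m (1%:M - slope_mx x y)| <= `|v| / 2.
  apply: le_trans (mx_norm_mulmx _ _) _.
  apply: (@le_trans _ _ (d%:R * `|v| * (2 * d.+1%:R)^-1)).
    by apply: ler_wpM2l => //; rewrite mulr_ge0.
  rewrite ler_pdivrMr ?mulr_gt0// mulrCA mulrA.
  have -> : 2 * (`|v| / 2) = `|v| by rewrite mulrC divfK.
  by rewrite mulrC ler_wpM2l// ler_nat.
have := lerB_dist v (v *m (1%:M - slope_mx x y)).
by move: H; lra.
Qed.


Lemma is_derive_chart x v : is_derive x v chart (chart_slope x x v).
Proof.
apply: is_derive_cvg.
have cv : (v : 'rV[R]_d) @[_ --> (0 : R)^'] --> v by exact: cvg_cst.
have cx : (x : 'rV[R]_d) @[_ --> (0 : R)^'] --> x by exact: cvg_cst.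
have : chart_slope (t *: v + x) x v @[t --> (0 : R)^'] --> chart_slope x x v.
  by apply: cvg_chart_slope => //; exact: cvg_line.
apply: cvg_trans; apply: near_eq_cvg; near=> t.
have t0 : t != 0 by near: t; exact: nbhs_dnbhs_neq.
rewrite chartB addrK /chart_slope [slice (t *: v)]linearZ linearZ /=.
by rewrite scalerA mulVf// scale1r.
Unshelve. all: by end_near. Qed.

Let slice_unit (t : R) x : 1%:M - t *: slice x \in unitmx.
Proof. by apply: gg_unit; rewrite memvZ. Qed.

Lemma chart_smooth U : smooth_on U chart.
Proof.
apply: (@cayley_word_smooth _ _ _ slice slice); last exact: cayley_conj_word.
- by move=> x v t; rewrite linearP.
- exact: slice_continuous.
- exact: slice_unit.
Qed.

Lemma line_continuous x v : continuous (fun t : R^o => t *: v + x : 'rV[R]_d).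
Proof.
move=> t; apply: (@cvgD _ _ _ (nbhs t)); last exact: cvg_cst.
by apply: (@cvgZr_tmp _ _ _ (nbhs t)); exact: cvg_id.
Qed.

Lemma chart_line_smooth (I : set R^o) x v :
  smooth_on I (fun t : R^o => chart (t *: v + x)).
Proof.
apply: (@cayley_word_smooth _ _ _ (fun t : R^o => slice (t *: v + x))
  (fun t : R^o => t *: slice v)).
- by move=> s t r; rewrite !linearP /= scalerDl addrA scalerA.
- move=> t; exact: (@cvg_comp _ _ _ _ _ _ _ _ (@line_continuous x v t)
    (@slice_continuous _)).
- by move=> *; exact: slice_unit.
exact: (@cayley_conj_word _ R^o _ (fun t : R^o => slice (t *: v + x)) p).
Qed.

Lemma derive_chart_line x v :
  'D_1 (fun t : R^o => chart (t *: v + x)) 0 = chart_slope x x v.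
Proof.
have dc : is_derive (0 : R^o) (1 : R^o) (fun t : R^o => chart (t *: v + x))
    (chart_slope x x v).
  apply: is_derive_cvg; have := is_derive_cvgE (is_derive_chart x v).
  apply: cvg_trans; apply: near_eq_cvg; near=> t.
  by rewrite addr0 scale0r add0r [t *: 1]mulr1.
by case: dc.
Unshelve. all: by end_near. Qed.

(** The image of one small chart suffices, so the open set [U] of the
parametrization is the whole space. *)
Lemma orbit_germ : exists N : set 'M[R]_m,
  [/\ N p, submanifold N & forall q, N q ->
   (exists2 X, X \in gg & q = cayley_orbit p X) /\
   tangent_space N q = [set Z | exists2 Y, Y \in gg & Z = ad q Y]].
Proof.
have [e e0 He] := coslice_expanding.
pose O := [set x : 'rV[R]_d | `|x| < e].
have O0 : O 0 by rewrite /O /= normr0.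
have Oo : open O.
  rewrite (_ : O = ball 0 e); first exact: ball_open.
  by apply/funext => x; rewrite -ball_normE /ball_/= sub0r normrN.
(* the default value 0 of [xget] lies in [O], so [k] takes all its values in [O],
   where the slopes are invertible *)
pose k q : 'rV[R]_d := xget 0 [set x | O x /\ chart x = q].
have hinj x y : O x -> O y -> chart x = chart y -> x = y.
  move=> Ox Oy /eqP; rewrite -subr_eq0 chartB => /eqP hxy.
  apply/eqP; rewrite -subr_eq0 -normr_le0.
  by apply: le_trans (He x y Ox Oy _) _; rewrite hxy linear0 normr0 mulr0.
have kO q : O (k q) by rewrite /k; case: xgetP => [x -> []|].
have hk q : (chart @` O) q -> chart (k q) = q.
  by move=> [x Ox hx]; rewrite /k; case: xgetP => [y -> []//|/(_ x)[]].
have kh x : O x -> k (chart x) = x.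
  by move=> Ox; apply: hinj => //; apply: hk; exists x.
have klip q q' : (chart @` O) q -> (chart @` O) q' ->
    `|k q - k q'| <= 2 * `|coslice q - coslice q'|.
  move=> Nq Nq'; apply: le_trans (He _ _ (kO q) (kO q') _) _.
  by rewrite -chartB !hk// linearB.
have kcont q : (chart @` O) q -> forall (T : Type) (F : set_system T), Filter F ->
    forall c : T -> 'M[R]_m, (\forall t \near F, (chart @` O) (c t)) -> c @ F --> q ->
    k (c t) @[t --> F] --> k q.
  move=> Nq T F FF c Nc cq; apply/cvgrPdist_le => /= r r0.
  have cc' : coslice (c t) @[t --> F] --> coslice q.
    exact: (@cvg_comp _ _ _ _ _ _ _ _ cq (@coslice_continuous q)).
  near=> t; apply: le_trans (klip _ _ Nq _) _; first by near: t.
  rewrite mulrC -ler_pdivlMr//; near: t.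
  by move/cvgrPdist_le : cc'; apply; rewrite divr_gt0.
exists (chart @` O); split.
- exists 0 => //; rewrite /chart linear0 /cayley_orbit oppr0 cayley0.
  by rewrite mul1mx mulmx1.
- exists d => q Nq; exists O, setT, chart; split => //; split => //.
  + by split=> //; exact: openT.
  + exact: chart_smooth.
  + move=> x v Ox; have [_ ->] := is_derive_chart x v => dv.
    apply/eqP; rewrite -normr_le0; apply: le_trans (He x x Ox Ox v) _.
    by rewrite dv linear0 normr0 mulr0.
  + by rewrite setIT.
  + exists k => //; rewrite setIT; apply/subspace_continuousP => x Nx.
    apply: kcont => //; first exact: withinT.
    exact: cvg_within.
move=> q [x Ox <-]; split; first by exists (slice x).
have dim_le : (\dim (ad (chart x) @: gg) <= d)%N.
  apply: leq_trans (dim_ad_orbit p gg_unit gg_cayley (slice_in x)) _.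
  by rewrite -limg_ker_compl limg_dim_eq// capv_diff.
pose dchart : 'Hom('rV[R]_d, 'M[R]_m) :=
  linfun (orbit_slope p (slice x) (slice x) \o slice).
have dchartE v : dchart v = chart_slope x x v by rewrite lfunE.
have imE : limg dchart = (ad (chart x) @: gg)%VS.
  apply/eqP; rewrite eqEdim; apply/andP; split.
    apply/subvP => _ /memv_imgP[v _ ->].
    rewrite dchartE /chart_slope (orbit_slope_diag _ gg_unit)//; apply: memv_img.
    by apply: memvZ; apply: gg_resolvent.
  apply: leq_trans dim_le _; rewrite limg_dim_eq.
    by rewrite dimvf dim_matrix -[leqLHS](mul1n d).
  apply/eqP; rewrite -subv0; apply/subvP => v.
  rewrite capfv memv_ker memv0 dchartE => /eqP dv.
  rewrite -normr_le0; apply: le_trans (He x x Ox Ox v) _.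
  by rewrite dv linear0 normr0 mulr0.
apply/seteqP; split => w /=.
  move=> [I [c [[Io I0] cs cN c0 <-]]].
  have [cc0 dc0] := cs [::] 0 I0; rewrite /= in cc0 dc0.
  have Inear : \forall t \near (0 : R)^', I t.
    by apply: nbhs_dnbhs; exact: (open_nbhs_nbhs (conj Io I0)).
  have ccv : c t @[t --> (0 : R)^'] --> chart x.
    by rewrite -c0; exact: (cvg_trans (cvg_app _ (@nbhs_dnbhs _ _)) cc0).
  have Nnear : \forall t \near (0 : R)^', (chart @` O) (c t).
    by apply: filterS Inear => t It; exact: cN.
  have Nhx : (chart @` O) (chart x) by exists x.
  have ky := kcont _ Nhx _ _ _ _ Nnear ccv; rewrite kh// in ky.
  have dq : t^-1 *: (c t - chart x) @[t --> (0 : R)^'] --> 'D_1 c 0.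
    have /is_derive_cvgE := derivableP (dc0 1).
    rewrite c0; apply: cvg_trans; apply: near_eq_cvg; near=> t.
    by rewrite /GRing.scale/= mulr1 addr0.
  (* [u t] is [(k (c t) - x) / t], written so that its limit is visible: solve
     the difference formula for the increment of the coordinates *)
  pose u t := coslice (t^-1 *: (c t - chart x)) *m invmx (slope_mx (k (c t)) x).
  have uslope y : O y -> slope_mx y x \in unitmx.
    move=> Oy; rewrite -row_free_unit; apply/inj_row_free => v.
    rewrite slope_mxE => v0; apply/eqP; rewrite -normr_le0.
    by apply: le_trans (He y x Oy Ox v) _; rewrite v0 normr0 mulr0.
  have cx : (x : 'rV[R]_d) @[_ --> (0 : R)^'] --> x by exact: cvg_cst.
  have cu : u t @[t --> (0 : R)^'] --> coslice ('D_1 c 0) *m invmx (slope_mx x x).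
    apply: cvg_mulmx.
      exact: (@cvg_comp _ _ _ _ _ _ _ _ dq (@coslice_continuous _)).
    apply: cvg_invmx; [by move=> t; exact: uslope|exact: uslope|].
    by apply: cvg_slope_mx; [exact: ky|exact: cx].
  have : chart_slope (k (c t)) x (u t) @[t --> (0 : R)^'] -->
         chart_slope x x (coslice ('D_1 c 0) *m invmx (slope_mx x x)).
    by apply: cvg_chart_slope; [exact: ky|exact: cx|exact: cu].
  have E : \forall t \near (0:R)^',
      chart_slope (k (c t)) x (u t) = t^-1 *: (c t - chart x).
    near=> t; have Nct : (chart @` O) (c t) by near: t.
    have chx : c t - chart x = chart_slope (k (c t)) x (k (c t) - x).
      by rewrite -chartB hk.
    have -> : u t = t^-1 *: (k (c t) - x).
      rewrite /u linearZ /= chx -slope_mxE scalemxAl -mulmxA mulmxV ?mulmx1//.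
      exact: uslope.
    by rewrite chx /chart_slope [slice (t^-1 *: _)]linearZ linearZ.
  move=> H; have {}H := cvg_trans (near_eq_cvg E) H.
  have -> : 'D_1 c 0 = chart_slope x x (coslice ('D_1 c 0) *m invmx (slope_mx x x)).
    transitivity (lim (t^-1 *: (c t - chart x) @[t --> (0 : R)^'])).
      by apply/esym/cvg_lim; [exact: norm_hausdorff|exact: dq].
    by apply/cvg_lim; [exact: norm_hausdorff|exact: H].
  have : dchart (coslice ('D_1 c 0) *m invmx (slope_mx x x)) \in limg dchart.
    by rewrite memv_img ?memvf.
  by rewrite imE dchartE => /memv_imgP[Y gY EY]; exists Y.
move=> [Y gY wE].
have : w \in limg dchart by rewrite imE wE memv_img.
move=> /memv_imgP[v _ ->]; rewrite dchartE.
exists [set t : R^o | O (t *: v + x)], (fun t : R^o => chart (t *: v + x)); split.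
- split; last by rewrite /= scale0r add0r.
  apply: (@open_comp _ _ (fun t : R^o => t *: v + x)) => // t _.
  exact: line_continuous.
- exact: chart_line_smooth.
- by move=> t It; exists (t *: v + x).
- by rewrite scale0r add0r.
- exact: derive_chart_line.
Unshelve. all: by end_near. Qed.

End Germ.

(** * Endomorphisms and their matrices *)

(** A subspace of maximal dimension among those contained in [P] is all of [P]. *)
Lemma linear_subspace_vspace (F : fieldType) (W : vectType F) (P : W -> Prop) :
  P 0 -> (forall a x y, P x -> P y -> P (a *: x + y)) ->
  exists U : {vspace W}, forall x, x \in U <-> P x.
Proof.
move=> P0 PP.
pose good n := `[< exists U : {vspace W}, (forall x, x \in U -> P x) /\ \dim U = n >].
have ex0 : exists n, good n.
  exists 0%N; apply/asboolP; exists 0%VS; split; last exact: dimv0.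
  by move=> x; rewrite memv0 => /eqP ->.
have bnd n : good n -> (n <= \dim {:W})%N.
  by move=> /asboolP[U [_ <-]]; apply: dimvS; exact: subvf.
case: (ex_maxnP ex0 bnd) => n /asboolP[U [UP dimU]] nmax.
exists U => x; split; first exact: UP.
move=> Px; suff -> : U = (U + <[x]>)%VS by exact: (subvP (addvSr _ _)) (memv_line x).
apply/eqP; rewrite eqEdim addvSl dimU /=; apply: nmax; apply/asboolP.
exists (U + <[x]>)%VS; split=> // _ /memv_addP[u Uu [_ /vlineP[a ->] ->]].
by rewrite addrC; apply: PP => //; exact: UP.
Qed.

Section Matrices.
Context {R : realType} {V : vectType R}.
Implicit Types A B K : 'End(V).

Let bas : basis_of {:V} (vbasis {:V}) := vbasisP _.

Lemma endo_mxK : cancel (@endo_mx R V) mx_endo.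
Proof. exact: passmx.mxofK. Qed.

Lemma mx_endoK : cancel (@mx_endo R V) endo_mx.
Proof. exact: passmx.hommxK. Qed.

Lemma endo_mx_is_linear : linear (@endo_mx R V).
Proof. exact: passmx.mxof_linear. Qed.
HB.instance Definition _ := GRing.isSemilinear.Build R 'End(V)
  'M[R]_(\dim {:V}) _ (@endo_mx R V) (GRing.semilinear_linear endo_mx_is_linear).

Lemma mx_endo_is_linear : linear (@mx_endo R V).
Proof. exact: passmx.hommx_linear. Qed.
HB.instance Definition _ := GRing.isSemilinear.Build R 'M[R]_(\dim {:V})
  'End(V) _ (@mx_endo R V) (GRing.semilinear_linear mx_endo_is_linear).

(** Matrices act on row vectors, so composition is reversed. *)
Lemma endo_mx_comp A B : endo_mx (A \o B)%VF = endo_mx B *m endo_mx A.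
Proof. exact: passmx.mxof_comp. Qed.

Lemma mx_endo_mul (M N : 'M[R]_(\dim {:V})) :
  mx_endo (M *m N) = (mx_endo N \o mx_endo M)%VF.
Proof. exact: passmx.hommx_mul. Qed.

Lemma endo_mx1 : endo_mx \1%VF = 1%:M :> 'M[R]_(\dim {:V}).
Proof. by apply: passmx.mxof1; exact: basis_free bas. Qed.

Lemma mx_endo1 : mx_endo 1%:M = \1%VF :> 'End(V).
Proof. exact: passmx.hommx1. Qed.

Lemma endo_mx_unit A : (forall v, A v = 0 -> v = 0) -> endo_mx A \in unitmx.
Proof.
move=> Ainj; rewrite -row_free_unit; apply/inj_row_free => u.
rewrite /endo_mx passmx.mul_mxof => /eqP; rewrite passmx.rVof_eq0// => /eqP/Ainj.
by move/eqP; rewrite passmx.vecof_eq0// => /eqP.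
Qed.

Lemma endo_char_poly_conj A (a b : 'End(V)) : (a \o b)%VF = \1%VF ->
  endo_char_poly (a \o A \o b)%VF = endo_char_poly A.
Proof.
move=> ab; rewrite /endo_char_poly !endo_mx_comp.
have : endo_mx b *m endo_mx a = 1%:M by rewrite -endo_mx_comp ab endo_mx1.
move: (endo_mx A) (endo_mx a) (endo_mx b) => M N N' NN.
pose C := map_mx (@polyC R).
have CC : C _ _ N' *m C _ _ N = 1%:M by rewrite /C -map_mxM NN map_mx1.
rewrite /char_poly /char_poly_mx.
have -> : 'X%:M - map_mx polyC (N' *m (M *m N)) =
    C _ _ N' *m ('X%:M - map_mx polyC M) *m C _ _ N.
  by rewrite mulmxBr mulmxBl mul_mx_scalar -scalemxAl CC -!map_mxM mulmxA scalemx1.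
rewrite !det_mulmx mulrAC -det_mulmx -[RHS]mul1r; congr (_ * _).
by rewrite CC det1.
Qed.

End Matrices.

Section Metric.
Context {R : realType} {V : vectType R} (g : {dot V for idfun}).

Lemma dotC u v : g u v = g v u.
Proof. by rewrite (hermitian_subproof u v) /= expr0 mul1r. Qed.

Lemma dotBl u v w : g (u - v) w = g u w - g v w.
Proof. exact: linearBl. Qed.
Lemma dotDl u v w : g (u + v) w = g u w + g v w.
Proof. exact: linearDl. Qed.
Lemma dotDr u v w : g w (u + v) = g w u + g w v.
Proof. exact: linearDr. Qed.
Lemma dotBr u v w : g w (u - v) = g w u - g w v.
Proof. exact: linearBr. Qed.
Lemma dotNr u w : g w (- u) = - g w u.
Proof. exact: linearNr. Qed.
Lemma dotNl u w : g (- u) w = - g u w.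
Proof. exact: linearNl. Qed.
Lemma dotZl a u w : g (a *: u) w = a * g u w.
Proof. exact: linearZl_LR. Qed.
Lemma dotZr a u w : g w (a *: u) = a * g w u.
Proof. by rewrite dotC dotZl dotC. Qed.

Lemma dot_eq0 u : g u u = 0 -> u = 0.
Proof.
move=> u0; apply/eqP/negP => /negP/(neq0_dnorm_gt0 (s := g)).
by rewrite u0 ltxx.
Qed.

End Metric.

(** * The Lie algebra of admissible endomorphisms *)

Section Stabilizer.
Context {R : realType} {V : vectType R} (g : {dot V for idfun}).
Variables (J P : 'End(V)).
Implicit Types A B K a b : 'End(V).

(** The endomorphisms whose brackets with [K] span the distribution at [K], when
[P] is the value of the section there. *)
Definition admissible_alg B :=
  [/\ unitary_alg g J B, forall v, v \in lker P -> B v = 0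
    & forall v, v \in limg P -> B v \in limg P].

(** The properties of a map obtained from [admissible_alg] by rational functions
equal to 1 at 0, except for orthogonality.  Resolvents satisfy them as well as
Cayley transforms, so that both are treated together. *)
Definition admissible_map a :=
  [/\ forall v, a (J v) = J (a v), forall v, v \in lker P -> a v = v
    & forall v, v \in limg P -> a v \in limg P].

Definition adjoint_maps a b := forall u v, g (a u) v = g u (b v).

Lemma commutator0P A K : commutator A K = 0 <-> forall v, A (K v) = K (A v).
Proof.
split=> [AK v|AK].
  apply/eqP; rewrite -subr_eq0.
  have /lfunP/(_ v) := AK.
  by rewrite /commutator add_lfunE opp_lfunE !comp_lfunE zero_lfunE => ->.
apply/lfunP => v; rewrite /commutator add_lfunE opp_lfunE !comp_lfunE zero_lfunE.
by rewrite AK subrr.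
Qed.

Lemma admissible_alg_vspace : exists gg : {vspace 'M[R]_(\dim {:V})},
  forall X, X \in gg <-> admissible_alg (mx_endo X).
Proof.
apply: linear_subspace_vspace.
  rewrite linear0; split=> [|v _|v _]; rewrite ?zero_lfunE ?mem0v//.
  split; last by apply/commutator0P => v; rewrite !zero_lfunE linear0.
  by move=> u v; rewrite !zero_lfunE -(subrr 0) dotBl dotBr !subrr oppr0.
move=> c X Y [[sX /commutator0P jX] kX iX] [[sY /commutator0P jY] kY iY].
rewrite linearP; split.
- split; first by move=> u v; rewrite !add_lfunE !scale_lfunE dotDl dotDr dotZl
    dotZr sX sY mulrN opprD.
  apply/commutator0P => v; rewrite !add_lfunE !scale_lfunE jX jY.
  by rewrite linearD linearZ.
- by move=> v kv; rewrite add_lfunE scale_lfunE kX// kY// scaler0 addr0.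
- by move=> v iv; rewrite add_lfunE scale_lfunE memvD// ?memvZ ?iX ?iY.
Qed.

(** Adjointness of [a] and [b] keeps the product skew.  The pair is adjoint rather
than inverse so that resolvents are covered along with Cayley transforms. *)
Lemma conj_admissible_alg a b B : admissible_map a -> admissible_map b ->
  adjoint_maps a b -> admissible_alg B -> admissible_alg (a \o B \o b)%VF.
Proof.
move=> [ja ka ia] [jb kb ib] ab [[sB /commutator0P jB] kB iB]; split.
- split.
    move=> u v; rewrite !comp_lfunE ab sB.
    by rewrite (dotC g (b u)) -ab (dotC g u).
  by apply/commutator0P => v; rewrite !comp_lfunE jb jB ja.
- by move=> v kv; rewrite !comp_lfunE kb// kB// linear0.
- by move=> v iv; rewrite !comp_lfunE ia// iB// ib.
Qed.

(** A skew endomorphism has no eigenvalue 1, since [g (B v) v = 0]. *)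
Lemma skew_unit B : skew_endo g B -> 1%:M - endo_mx B \in unitmx.
Proof.
move=> sB; have -> : 1%:M - endo_mx B = endo_mx (\1 - B)%VF :> 'M[R]_(\dim {:V}).
  by rewrite linearB /= endo_mx1.
apply: endo_mx_unit => v; rewrite add_lfunE opp_lfunE id_lfunE.
move=> /eqP; rewrite subr_eq0 => /eqP vB; apply: (@dot_eq0 _ _ g).
have := sB v v; rewrite -vB => /eqP.
by rewrite -subr_eq0 opprK -mulr2n mulrn_eq0 /= => /eqP.
Qed.

Lemma mx_endo_resolventK B v : skew_endo g B ->
  mx_endo (resolvent (endo_mx B)) (v - B v) = v.
Proof.
move=> sB; have := mulBmx_resolvent (skew_unit sB); move/(congr1 mx_endo).
rewrite mx_endo_mul linearB /= mx_endo1 endo_mxK => /lfunP/(_ v).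
by rewrite comp_lfunE add_lfunE opp_lfunE !id_lfunE.
Qed.

Lemma mx_endo_resolventVK B v : skew_endo g B ->
  let r := mx_endo (resolvent (endo_mx B)) in r v - B (r v) = v.
Proof.
move=> sB; have := resolvent_mulBmx (skew_unit sB); move/(congr1 mx_endo).
rewrite mx_endo_mul linearB /= mx_endo1 endo_mxK => /lfunP/(_ v).
by rewrite comp_lfunE add_lfunE opp_lfunE !id_lfunE.
Qed.

(** [1 - B] is injective and maps the image of [P] into itself, hence onto
itself, so its inverse preserves that image too. *)
Lemma resolvent_admissible B : admissible_alg B ->
  admissible_map (mx_endo (resolvent (endo_mx B))).
Proof.
move=> [[sB /commutator0P jB] kB iB]; set r := mx_endo _.
have rK v : r (v - B v) = v := mx_endo_resolventK v sB.
have Kr v : r v - B (r v) = v := mx_endo_resolventVK v sB.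
split.
- by move=> v; rewrite -{1}[v]Kr linearB /= -jB rK.
- by move=> v kv; rewrite -{1}[v]subr0 -(kB _ kv) rK.
pose f : 'End(V) := (\1 - B)%VF.
have fE v : f v = v - B v by rewrite /f add_lfunE opp_lfunE id_lfunE.
have fi : (f @: limg P = limg P)%VS.
  apply/eqP; rewrite eqEdim; apply/andP; split.
    by apply/subvP => _ /memv_imgP[v vP ->]; rewrite fE memvB// iB.
  rewrite [leqRHS]limg_dim_eq//; apply/eqP; rewrite -subv0; apply/subvP => v.
  rewrite memv_cap memv_ker memv0 fE => /andP[_ /eqP v0].
  by rewrite -[v]rK v0 linear0.
by move=> v; rewrite -{1}fi => /memv_imgP[w wP ->]; rewrite fE rK.
Qed.

Lemma cayley_admissible B : admissible_alg B ->
  admissible_map (mx_endo (cayley (endo_mx B))).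
Proof.
move=> /resolvent_admissible[jr kr ir].
have cE v : mx_endo (cayley (endo_mx B)) v =
    2 *: mx_endo (resolvent (endo_mx B)) v - v.
  by rewrite cayley.unlock linearB linearZ /= mx_endo1 add_lfunE scale_lfunE
    opp_lfunE id_lfunE.
split=> v; rewrite !cE.
- by rewrite jr linearB linearZ.
- by move=> kv; rewrite kr// scaler_nat mulr2n addrK.
- by move=> iv; rewrite memvB// memvZ// ir.
Qed.

Lemma admissible_algN B : admissible_alg B -> admissible_alg (- B).
Proof.
move=> [[sB /commutator0P jB] kB iB]; split.
- split; first by move=> u v; rewrite !opp_lfunE dotNl dotNr sB.
  by apply/commutator0P => v; rewrite !opp_lfunE jB linearN.
- by move=> v kv; rewrite opp_lfunE kB// oppr0.
- by move=> v kv; rewrite opp_lfunE memvN iB.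
Qed.

Lemma resolvent_adjoint B : admissible_alg B ->
  adjoint_maps (mx_endo (resolvent (- endo_mx B))) (mx_endo (resolvent (endo_mx B))).
Proof.
move=> GB u v; have [[sB _] _ _] := GB.
have [[sN _] _ _] := admissible_algN GB.
have Kr := mx_endo_resolventVK v sB.
have := mx_endo_resolventVK u sN; rewrite linearN /= opp_lfunE opprK => KrN.
by rewrite -{1}Kr -{2}KrN dotBr dotDl sB.
Qed.

Lemma cayley_adjoint B : admissible_alg B ->
  adjoint_maps (mx_endo (cayley (- endo_mx B))) (mx_endo (cayley (endo_mx B))).
Proof.
move=> GB u v; rewrite cayley.unlock !linearB !linearZ /= !mx_endo1.
rewrite !add_lfunE !scale_lfunE !opp_lfunE !id_lfunE.
by rewrite dotBl dotBr dotZl dotZr resolvent_adjoint.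
Qed.

End Stabilizer.

(** * Equivariance under the unitary group *)

Section Conjugation.
Context {R : realType} {V : vectType R} (g : {dot V for idfun}).
Variables (J : 'End(V)).
Implicit Types A B K a b : 'End(V).

(** [a] belongs to [U(V, J)] and [b] is its inverse; carrying both avoids inverting
endomorphisms. *)
Definition unitary_pair a b :=
  [/\ (a \o b)%VF = \1%VF, (b \o a)%VF = \1%VF, adjoint_maps g a b,
      forall v, a (J v) = J (a v) & forall v, b (J v) = J (b v)].

Section Pair.
Variables a b : 'End(V).
Hypothesis ab : unitary_pair a b.

Let abK v : a (b v) = v.
Proof. by have [/lfunP/(_ v) + _ _ _ _] := ab; rewrite comp_lfunE id_lfunE. Qed.

Let baK v : b (a v) = v.
Proof. by have [_ /lfunP/(_ v) + _ _ _] := ab; rewrite comp_lfunE id_lfunE. Qed.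

Lemma twistor_conj K : twistor g K -> twistor g (a \o K \o b)%VF.
Proof.
move=> [KK gK]; have [_ _ adj _ _] := ab; split.
  apply/lfunP => v; rewrite !comp_lfunE baK.
  have /lfunP/(_ (b v)) := KK; rewrite comp_lfunE opp_lfunE id_lfunE => ->.
  by rewrite [RHS]opp_lfunE id_lfunE linearN /= abK.
move=> u v; rewrite !comp_lfunE adj baK gK.
by rewrite (dotC g (b u)) -adj abK dotC.
Qed.

Definition conj_endo A := (a \o A \o b)%VF.

Lemma conj_endoE A v : conj_endo A v = a (A (b v)).
Proof. by rewrite !comp_lfunE. Qed.

Lemma conj_endo_is_linear : linear conj_endo.
Proof.
move=> c A B; apply/lfunP => v.
by rewrite add_lfunE scale_lfunE !conj_endoE add_lfunE scale_lfunE linearP.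
Qed.
HB.instance Definition _ := GRing.isSemilinear.Build R 'End(V) 'End(V) _ conj_endo
  (GRing.semilinear_linear conj_endo_is_linear).

Lemma conj_endo_comp A B : conj_endo (A \o B)%VF = (conj_endo A \o conj_endo B)%VF.
Proof. by apply/lfunP => v; rewrite !comp_lfunE baK. Qed.

Lemma conj_endo1 : conj_endo \1%VF = \1%VF.
Proof. by apply/lfunP => v; rewrite !comp_lfunE !id_lfunE abK. Qed.

Lemma conj_endoJ : conj_endo J = J.
Proof. by have [_ _ _ ja _] := ab; apply/lfunP => v; rewrite !comp_lfunE ja abK. Qed.

Lemma conj_endo_commutator K : conj_endo (commutator J K) = commutator J (conj_endo K).
Proof. by rewrite /commutator linearB /= !conj_endo_comp conj_endoJ. Qed.

Lemma conj_endo_anticommutator K :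
  conj_endo (anticommutator J K) = anticommutator J (conj_endo K).
Proof. by rewrite /anticommutator linearD /= !conj_endo_comp conj_endoJ. Qed.

Lemma conj_endo_exp A i : conj_endo (endo_exp A i) = endo_exp (conj_endo A) i.
Proof.
elim: i => [|i ih]; first exact: conj_endo1.
by rewrite /endo_exp /= conj_endo_comp -/(endo_exp A i) ih.
Qed.

End Pair.
End Conjugation.

Section AdmissibleConj.
Context {R : realType} {V : vectType R} (g : {dot V for idfun}).
Variables (J P a b : 'End(V)).
Hypothesis ab : unitary_pair g J a b.
Hypothesis aP : admissible_map J P a.
Hypothesis bP : admissible_map J P b.

(** The maps [a] and [b] fix the kernel of [P] pointwise and preserve its image. *)
Lemma lker_conj : lker (conj_endo a b P) = lker P.
Proof.
have [_ ka ia] := aP; have [_ kb ib] := bP.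
have [/lfunP aK /lfunP bK _ _ _] := ab.
apply/vspaceP => v; rewrite !memv_ker conj_endoE; apply/eqP/eqP => v0.
  have Pbv : P (b v) = 0.
    by rewrite -[P _]id_lfunE -bK comp_lfunE v0 linear0.
  have kbv : b v \in lker P by rewrite memv_ker Pbv.
  have := ka _ kbv; rewrite -comp_lfunE aK id_lfunE => ->.
  exact: Pbv.
by rewrite kb ?memv_ker ?v0// linear0.
Qed.

Lemma limg_conj : limg (conj_endo a b P) = limg P.
Proof.
have [_ ka ia] := aP; have [_ kb ib] := bP.
have [/lfunP aK /lfunP bK _ _ _] := ab.
apply/vspaceP => v; apply/idP/idP.
  move=> /memv_imgP[w _ ->]; rewrite conj_endoE; apply: ia.
  exact: memv_img (memvf _).
move=> /ib /memv_imgP[w _ bv].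
have -> : v = conj_endo a b P (a w).
  rewrite conj_endoE -[b (a w)]comp_lfunE bK id_lfunE -bv.
  by rewrite -comp_lfunE aK id_lfunE.
exact: memv_img (memvf _).
Qed.

Lemma admissible_alg_conj B :
  admissible_alg g J (conj_endo a b P) B <-> admissible_alg g J P B.
Proof. by rewrite /admissible_alg lker_conj limg_conj. Qed.

End AdmissibleConj.

(** * Integrability of equivariant distributions *)

Section Distribution.
Context {R : realType} {V : vectType R} (g : {dot V for idfun}).
Implicit Types A B K : 'End(V).

(** [K] is itself skew, being orthogonal with square [-1]; this makes [[B, K]]
skew, and [[B, K]] anticommutes with [K] because [K] has scalar square. *)
Lemma skew_acomm_commutator B K : twistor g K -> skew_endo g B ->
  skew_acomm g K (commutator B K).
Proof.
move=> [KK gK] sB.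
have KKv v : K (K v) = - v.
  by have /lfunP/(_ v) := KK; rewrite comp_lfunE opp_lfunE id_lfunE.
have sK : skew_endo g K.
  by move=> u v; rewrite -[v in LHS]opprK -(KKv v) dotNr gK.
have cE v : commutator B K v = B (K v) - K (B v).
  by rewrite /commutator add_lfunE opp_lfunE !comp_lfunE.
split.
  by move=> u v; rewrite !cE dotBl dotBr sB sK sK sB !opprK opprB.
apply/lfunP => v; rewrite /anticommutator add_lfunE !comp_lfunE !cE linearB /=.
by rewrite !KKv linearN /= addrA subrK opprK addNr zero_lfunE.
Qed.

(** The sign is absorbed by [gg]: matrices reverse products, so [[B, K]]
corresponds to [- ad (endo_mx K) (endo_mx B)]. *)
Lemma twistor_dist_mx J (P : 'End(V) -> 'End(V)) K
    (gg : {vspace 'M[R]_(\dim {:V})}) :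
  twistor g K ->
  (forall X, X \in gg <-> admissible_alg g J (P K) (mx_endo X)) ->
  @endo_mx R V @` twistor_dist g J P K =
    [set Z | exists2 Y, Y \in gg & Z = ad (endo_mx K) Y].
Proof.
move=> tK ggP; apply/seteqP; split.
  move=> _ [A [_ [B [uB kB iB ->]]] <-]; exists (- endo_mx B).
    by rewrite memvN; apply/ggP; rewrite endo_mxK.
  rewrite adE /commutator linearB /= !endo_mx_comp mulNmx mulmxN opprK.
  by rewrite addrC.
move=> Z [Y gY ->]; have /ggP[uB kB iB] : - Y \in gg by rewrite memvN.
exists (commutator (mx_endo (- Y)) K).
  split; last by exists (mx_endo (- Y)).
  by apply: skew_acomm_commutator => //; case: uB.
rewrite adE /commutator linearB /= !endo_mx_comp mx_endoK mulNmx mulmxN opprK.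
by rewrite addrC.
Qed.

(** Any equivariant section [P] gives an integrable distribution.  That the
distribution is tangent to the twistor space comes for free: it is tangent to
the integral submanifolds, which lie in that space. *)
Lemma twistor_dist_integrable J (P : 'End(V) -> 'End(V)) :
  (forall K a b, twistor g K -> unitary_pair g J a b ->
     P (conj_endo a b K) = conj_endo a b (P K)) ->
  integrable_on_twistor g (twistor_dist g J P).
Proof.
move=> Peq.
suff main p : (@endo_mx R V @` twistor g) p -> exists N : set 'M[R]_(\dim {:V}),
  [/\ N p, submanifold N & forall q, N q -> [/\ (@endo_mx R V @` twistor g) q,
     tangent_space N q = @endo_mx R V @` twistor_dist g J P (mx_endo q) &
     linear_subspace (@endo_mx R V @` twistor_dist g J P (mx_endo q))]].
  split=> p /main[N [Np Nsub Nq]].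
    have [_ tE lin] := Nq p Np; split=> //.
    rewrite -tE => w [I [c [I0 cs cN c0 dc]]]; exists I, c; split=> // t It.
    by have [] := Nq _ (cN t It).
  exists N => //; split=> //; first by move=> q /Nq[].
  by move=> q /Nq[].
move=> [K tK <-{p}].
have [gg ggP] := admissible_alg_vspace g J (P K).
have ggE X : X \in gg -> admissible_alg g J (P K) (mx_endo X) by move/ggP.
have gN X : X \in gg -> - X \in gg by rewrite memvN.
have gg_unit X : X \in gg -> 1%:M - X \in unitmx.
  by move=> /ggP[[sX _] _ _]; have := skew_unit sX; rewrite mx_endoK.
have ggr X Y : X \in gg -> Y \in gg -> resolvent X *m Y *m resolvent (- X) \in gg.
  move=> gX gY; apply/ggP; rewrite !mx_endo_mul comp_lfunA.
  apply: conj_admissible_alg; last exact: ggE.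
  - by have := resolvent_admissible (ggE _ (gN _ gX)); rewrite mx_endoK.
  - by have := resolvent_admissible (ggE _ gX); rewrite mx_endoK.
  - by have := resolvent_adjoint (ggE _ gX); rewrite mx_endoK.
have cadm X : X \in gg -> admissible_map J (P K) (mx_endo (cayley X)).
  by move=> gX; have := cayley_admissible (ggE _ gX); rewrite mx_endoK.
have cadj X : X \in gg -> adjoint_maps g (mx_endo (cayley (- X))) (mx_endo (cayley X)).
  by move=> gX; have := cayley_adjoint (ggE _ gX); rewrite mx_endoK.
have ggc X Y : X \in gg -> Y \in gg -> cayley X *m Y *m cayley (- X) \in gg.
  move=> gX gY; apply/ggP; rewrite !mx_endo_mul comp_lfunA.
  apply: conj_admissible_alg;
    [exact: cadm (gN _ gX)|exact: cadm|exact: cadj|exact: ggE].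
have [N [Np Nsub Nq]] := orbit_germ (endo_mx K) gg_unit ggr ggc.
exists N; split=> // q /Nq[[X gX qE] tE].
pose a := mx_endo (cayley (- X)); pose b := mx_endo (cayley X).
have uab : unitary_pair g J a b.
  have gNX := gN _ gX.
  have u1 : 1%:M + X \in unitmx by rewrite -[X]opprK gg_unit.
  have u2 : 1%:M + (- X) \in unitmx by exact: gg_unit.
  have [ja _ _] := cadm _ gNX; have [jb _ _] := cadm _ gX.
  split=> //; last exact: cadj.
  - by rewrite -mx_endo_mul cayley_mulN ?mx_endo1// gg_unit.
  - rewrite -mx_endo_mul -[X in _ *m cayley X]opprK cayley_mulN ?mx_endo1//.
    exact: gg_unit.
have qK : mx_endo q = conj_endo a b K.
  by rewrite qE /cayley_orbit !mx_endo_mul endo_mxK comp_lfunA.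
have tq : twistor g (mx_endo q) by rewrite qK; exact: (twistor_conj uab).
have TE : @endo_mx R V @` twistor_dist g J P (mx_endo q) =
    [set Z | exists2 Y, Y \in gg & Z = ad q Y].
  rewrite (@twistor_dist_mx _ _ _ gg)// ?mx_endoK// => Y.
  rewrite qK Peq//; apply: iff_trans (ggP Y) _; apply: iff_sym.
  by apply: admissible_alg_conj => //; [exact: cadm (gN _ gX)|exact: cadm].
split.
- by exists (mx_endo q) => //; rewrite mx_endoK.
- by rewrite tE TE.
- rewrite TE; split; first by exists 0; rewrite ?mem0v ?linear0.
  move=> c _ _ [Y gY ->] [Z gZ ->]; exists (c *: Y + Z); last by rewrite linearP.
  by rewrite memvD// memvZ.
Qed.

End Distribution.

Theorem theorem5p11 (R : realType) (n : nat) (V : vectType R)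
  (g : {dot V for idfun})
  (dimV : \dim {:V} = (2 * n)%N) (n_ge2 : (4 <= 2 * n)%N)
  (J : 'End(V)) (TJ : twistor g J)
  (f : 'I_(2 * n) -> 'End(V) -> R)
  (f_def : forall K, twistor g K ->
     endo_char_poly (anticommutator J K) =
       'X^(2 * n)
       + \sum_(j < 2 * n) ((-1) ^+ j.+1 * f j K) *: 'X^(2 * n - j.+1))
  (k : nat) (a : 'I_k.+1 -> 'End(V) -> R)
  (a_smooth : forall i, smooth_on_twistor g (a i))
  (a_poly : forall i, exists p : mpoly.mpoly (2 * n) R,
     forall K, twistor g K -> a i K = mpoly.meval (fun j => f j K) p)
  (Q S : 'End(V) -> 'End(V))
  (Q_def : forall K, twistor g K ->
     Q K = \sum_(i < k.+1) a i K *: endo_exp (anticommutator J K) i)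
  (S_def : [\/ forall K, twistor g K -> S K = \1%VF,
               forall K, twistor g K -> S K = J + K,
               forall K, twistor g K -> S K = J - K
             | forall K, twistor g K -> S K = commutator J K]) :
  integrable_on_twistor g (twistor_dist g J (fun K => (Q K \o S K)%VF)).
Proof.
apply: twistor_dist_integrable => K u v tK uv.
have tK' : twistor g (conj_endo u v K) := twistor_conj uv tK.
(* the coefficients of the characteristic polynomial determine [f j] *)
have fE j : f j (conj_endo u v K) = f j K.
  have coefE L : twistor g L ->
      (endo_char_poly (anticommutator J L))`_(2 * n - j.+1) = (-1) ^+ j.+1 * f j L.
    move=> tL; rewrite f_def// coefD coefXn ltn_eqF ?ltn_subrL//; last first.
      by rewrite (leq_trans _ (ltn_ord j)).
    rewrite add0r coef_sum (bigD1 j)//= coefZ coefXn eqxx mulr1.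
    rewrite big1 ?addr0// => i ij; rewrite coefZ coefXn.
    rewrite (_ : (_ == _)%N = false) ?mulr0//; apply: contraNF ij => /eqP ij.
    apply/eqP/val_inj; apply: succn_inj => /=.
    by rewrite -[LHS](subKn (ltn_ord i)) -ij subKn// ltn_ord.
  have uv1 : (u \o v)%VF = \1%VF by case: uv.
  have := coefE _ tK'; rewrite -(conj_endo_anticommutator uv) endo_char_poly_conj//.
  by rewrite coefE// => /(congr1 (fun z => (-1) ^+ j.+1 * z)); rewrite !signrMK.
have aE i : a i (conj_endo u v K) = a i K.
  have [p aip] := a_poly i; rewrite !aip//.
  by congr (mpoly.meval _ p); apply/funext => j; exact: fE.
rewrite (conj_endo_comp uv); congr (_ \o _)%VF.
  rewrite !Q_def// linear_sum /=; apply: eq_bigr => i _.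
  by rewrite linearZ /= aE (conj_endo_exp uv) (conj_endo_anticommutator uv).
case: S_def => SE; rewrite !SE//.
- by rewrite (conj_endo1 uv).
- by rewrite linearD /= (conj_endoJ uv).
- by rewrite linearB /= (conj_endoJ uv).
- by rewrite (conj_endo_commutator uv).
Qed.
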